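(* Every Christoffel word over the alphabet $\{a,b\}$ is strongly factor-symmetric.
   Context: Words are finite words over the alphabet $\{a,b\}$. A factor of a word $w$ is a contiguous subword (including the empty word and $w$ itself). The Parikh image of a word $x$ is $\gamma(x)=(|x|_a,|x|_b)$, the numbers of occurrences of $a$ and of $b$ in $x$. For a word $w$, define $\delta_w:\mathbb N^2\to\mathbb N$ by $\delta_w(i,j)=$ the number of distinct factors of $w$ whose Parikh image is $(i,j)$. A word $w$ with Parikh image $(p,q)$ is strongly factor-symmetric if $\delta_w(i,j)=\delta_w(p-i,q-j)$ for all integers $0\le i\le p$, $0\le j\le q$. A palindrome is a word equal to its reversal. A Christoffel word over $\{a,b\}$ is either the word $a$, or the word $b$, or a word $w$ of the form $w=amb$ or $w=bma$ where $m$ is a palindrome and $w$ is a product of two palindromes. *)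

(* Defs.v *)
From mathcomp Require Import all_boot.

Set Implicit Arguments.
Unset Strict Implicit.
Unset Printing Implicit Defensive.

(* The alphabet {a, b} is encoded by the two booleans. *)
Definition letter : finType := bool.
Definition a : letter := false.
Definition b : letter := true.

Definition word := seq letter.

Definition parikh (x : word) : nat * nat := (count_mem a x, count_mem b x).

(* The distinct factors of w with Parikh image (i, j). Ranging over the words
   of length at most |w| loses nothing, since no factor of w is longer. *)
Definition delta (w : word) (i j : nat) : nat :=
  #|[set x : (size w).-bseq letter | infix x w & parikh x == (i, j)]|.

Definition strongly_factor_symmetric (w : word) : Prop :=
  forall i j : nat, i <= (parikh w).1 -> j <= (parikh w).2 ->
    delta w i j = delta w ((parikh w).1 - i) ((parikh w).2 - j).

Definition palindrome (x : word) : Prop := rev x = x.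

Definition christoffel (w : word) : Prop :=
  [\/ w = [:: a], w = [:: b] |
   exists m : word,
    [/\ palindrome m,
        w = a :: rcons m b \/ w = b :: rcons m a &
        exists u v : word, [/\ palindrome u, palindrome v & w = u ++ v]]].

(* Main.v *)
(* Let w = u v with u, v palindromes. Every factor of w has exactly one
   occurrence that meets or touches the cut between u and v; hence factors are
   counted by windows [s, s + l) with s <= |u| <= s + l. The cyclic complement
   of such a window becomes, after reversal of u and of v, the window of length
   |w| - l at |u| - s, with the complementary Parikh image.

   Existence and uniqueness come from the rotation i |-> i + |u| modulo |w|:
   rotating w = x m y by |u| gives its reversal y m x, so the rotation preserves
   the letter at every position except 0 and -1. Going backwards along the
   orbit moves an occurrence until it meets the cut. The conjugates starting
   at r|u| and (r + 1)|u| differ by a swap of two adjacent letters, so the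
   number of y's in the first k letters never increases with r, and drops when
   r|u| + k = 0 modulo |w|, which separates the windows at the cut. *)
Require Import Defs.
From mathcomp Require Import all_boot.
From mathcomp Require Import zify.

Set Implicit Arguments.
Unset Strict Implicit.
Unset Printing Implicit Defensive.

(** * Windows and their reflection at a cut *)

Section Windows.
Variable T : Type.
Implicit Types (w : seq T) (s l : nat).

Definition window w s l : seq T := take l (drop s w).

Lemma size_window w s l : s + l <= size w -> size (window w s l) = l.
Proof. by move=> h; rewrite /window size_take_min size_drop; lia. Qed.

Lemma nth_window x0 w s l i :
  i < l -> nth x0 (window w s l) i = nth x0 w (s + i).
Proof. by move=> h; rewrite /window nth_take // nth_drop. Qed.

Lemma eq_window x0 w s t l : s + l <= size w -> t + l <= size w ->
  (forall i, i < l -> nth x0 w (s + i) = nth x0 w (t + i)) ->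
  window w s l = window w t l.
Proof.
move=> hs ht e; apply: (@eq_from_nth _ x0) => [|i]; rewrite !size_window //.
by move=> il; rewrite !nth_window ?e.
Qed.

Lemma window_cat w s l : w = take s w ++ window w s l ++ drop (s + l) w.
Proof. by rewrite /window addnC -drop_drop !cat_take_drop. Qed.

Definition occurs_at_cut (K : nat) w : Prop :=
  forall s l, s + l <= size w -> exists t,
    [/\ t <= K, K <= t + l, t + l <= size w & window w t l = window w s l].

Definition cut_occurrence_unique (K : nat) w : Prop :=
  forall s t l, s <= K -> K <= s + l -> s + l <= size w ->
    t <= K -> K <= t + l -> t + l <= size w ->
    window w s l = window w t l -> s = t.

(** As [u] and [v] are palindromes, the first window is the part of [u] before the second one,
    reversed, followed by the part of [v] after it, reversed. *)
Lemma count_reflected_window (u v : seq T) s l (p : pred T) :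
  rev u = u -> rev v = v ->
  s <= size u -> size u <= s + l -> s + l <= size (u ++ v) ->
  count p (window (u ++ v) (size u - s) (size (u ++ v) - l))
    + count p (window (u ++ v) s l) = count p (u ++ v).
Proof.
move=> pu pv h1 h2; rewrite size_cat => h3.
have -> : window (u ++ v) (size u - s) (size u + size v - l)
        = rev (take s u) ++ rev (drop (s + l - size u) v).
  rewrite rev_take rev_drop pu pv /window drop_cat.
  case: ltnP => h.
    rewrite take_cat size_drop.
    case: ltnP => h'; first by lia.
    by congr (_ ++ take _ _); lia.
  have s0 : s = 0 by lia.
  by rewrite s0 subn0 subnn drop0 drop_size /=; congr take; lia.
rewrite count_cat !count_rev [in RHS](window_cat (u ++ v) s l) !count_cat.
have -> : take s (u ++ v) = take s u by rewrite takel_cat.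
have -> : drop (s + l) (u ++ v) = drop (s + l - size u) v.
  by rewrite drop_cat; case: ltnP => // ?; lia.
lia.
Qed.

End Windows.

(** * Counting factors by windows at the cut *)

Lemma parikh_size (x : word) : (parikh x).1 + (parikh x).2 = size x.
Proof.
by rewrite -(count_predC (pred1 a)); congr (_ + _); apply: eq_count; case.
Qed.

Definition cut_windows (K : nat) (w : word) (i j : nat) : {set 'I_K.+1} :=
  [set s : 'I_K.+1 | [&& K <= s + (i + j), s + (i + j) <= size w &
                         parikh (window w s (i + j)) == (i, j)]].

Lemma delta_cut_windows K w i j : occurs_at_cut K w ->
  cut_occurrence_unique K w -> delta w i j = #|cut_windows K w i j|.
Proof.
move=> occ uniq.
have szw s : size (window w s (i + j)) <= size w.
  by rewrite /window size_take_min size_drop; lia.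
pose f (s : 'I_K.+1) := Bseq (szw s).
rewrite -(@card_in_imset _ _ f) => [|s t]; last first.
  rewrite !inE => /and3P[s1 s2 _] /and3P[t1 t2 _] /(congr1 val) /= e.
  by apply/val_inj/(uniq _ _ _ _ s1 s2 _ t1 t2 e); rewrite -ltnS.
apply: eq_card => -[x xle]; rewrite inE /=; apply/andP/imsetP => [[]|[s]].
  move=> /infixP[y [z ew]] /eqP px.
  have sx : size x = i + j by rewrite -parikh_size px.
  have le : size y + (i + j) <= size w.
    by rewrite ew !size_cat -sx leq_add2l leq_addr.
  have ex : window w (size y) (i + j) = x.
    by rewrite /window ew drop_size_cat // -sx take_size_cat.
  have [t [t1 t2 t3 et]] := occ _ _ le.
  rewrite -ltnS in t1; exists (Ordinal t1); last by apply/val_inj; rewrite /= et.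
  by rewrite inE /= t2 t3 et ex px eqxx.
rewrite inE => /and3P[s1 s2 s3] [->]; split=> //.
by apply/infixP; exists (take s w), (drop (s + (i + j)) w); rewrite -window_cat.
Qed.

Lemma unique_cut_occurrence_symmetric (u v : word) :
  palindrome u -> palindrome v -> occurs_at_cut (size u) (u ++ v) ->
  cut_occurrence_unique (size u) (u ++ v) -> strongly_factor_symmetric (u ++ v).
Proof.
move=> pu pv occ uniq.
(* One inequality suffices, because complementing [(i, j)] is an involution. *)
have le i j : i <= (parikh (u ++ v)).1 -> j <= (parikh (u ++ v)).2 ->
    delta (u ++ v) i j
    <= delta (u ++ v) ((parikh (u ++ v)).1 - i) ((parikh (u ++ v)).2 - j).
  move=> hi hj; rewrite !(delta_cut_windows _ _ occ uniq).
  rewrite -(card_imset _ (@rev_ord_inj _)); apply: subset_leq_card.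
  apply/subsetP => t /imsetP[s]; rewrite !inE => /and3P[s1 s2 /eqP ps] -> {t}.
  have sz := parikh_size (u ++ v).
  have sK : s <= size u by rewrite -ltnS.
  have -> : rev_ord s = size u - s :> nat by rewrite [LHS]subSS.
  have -> : (parikh (u ++ v)).1 - i + ((parikh (u ++ v)).2 - j)
          = size (u ++ v) - (i + j) by lia.
  apply/and3P; split; [by lia | by lia |].
  have eq p := count_reflected_window p pu pv sK s1 s2.
  case: ps => /= ea eb; rewrite /parikh -!eq /=.
  by rewrite [in X in _ == (X, _)]ea [in X in _ == (_, X)]eb !addnK.
move=> i j hi hj; apply/eqP; rewrite eqn_leq le //=.
by have := le _ _ (leq_subr i _) (leq_subr j _); rewrite !subKn.
Qed.

Lemma letter_symmetric (x : letter) : strongly_factor_symmetric [:: x].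
Proof.
(* The left palindrome is empty, so the cut is at 0. *)
rewrite -[[:: x]]cat0s; apply: unique_cut_occurrence_symmetric => //.
  move=> [|s] [|l] //= h; first by exists 0.
  - by exists 0.
  - by exists 0; rewrite /window !take0.
  - by lia.
by move=> [|s] [|t] l.
Qed.

(** * The rotation by [K] *)

Section Rotation.
Variables (T : eqType) (x y : T) (m u v : seq T).
Hypotheses (xy : x != y) (pm : rev m = m) (pu : rev u = u)
  (pv : rev v = v) (ew : x :: rcons m y = u ++ v).
Let w := u ++ v.
Let n := size w.
Let K := size u.

Let n_gt1 : 1 < n. Proof. by rewrite /n /w -ew /= size_rcons. Qed.

(** Otherwise [w = v] is a palindrome with distinct end letters. *)
Let K_gt0 : 0 < K.
Proof.
rewrite /K lt0n; apply/negP=> /nilP u0; move: pv ew.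
rewrite u0 /= => + e; rewrite -e rev_cons rev_rcons /=.
by case=> e'; move: xy; rewrite e' eqxx.
Qed.

Let K_ltn : K < n.
Proof.
rewrite /n /w size_cat -/K -[ltnLHS]addn0 ltn_add2l lt0n; apply/negP=> /nilP v0.
move: pu ew; rewrite v0 cats0 => + e; rewrite -e rev_cons rev_rcons.
by case=> e'; move: xy; rewrite e' eqxx.
Qed.

Let rot_w : rot K w = y :: rcons m x.
Proof.
by rewrite rot_size_cat -[v]pv -[u]pu -rev_cat -ew rev_cons rev_rcons pm.
Qed.

Let nth_rot_w i : i < n ->
  nth x w ((i + K) %% n) = nth x (y :: rcons m x) i.
Proof.
move=> hi; rewrite -rot_w /rot nth_cat size_drop -/n nth_drop.
case: ltnP => h; first by rewrite modn_small addnC //; lia.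
rewrite nth_take; last by lia.
have -> : i + K = i - (n - K) + n by lia.
by rewrite modnDr modn_small //; lia.
Qed.

Let isy i : nat := nth x w (i %% n) == y.

(* The divisibility terms account for the swap of the letters at -1 and 0. *)
Let isyD i : isy (i + K) + (n %| i.+1) = isy i + (n %| i).
Proof.
have n0 : 0 < n by lia.
rewrite /isy -modnDml nth_rot_w ?ltn_mod // /w -ew.
rewrite -[i.+1]addn1 /dvdn -(modnDml i 1).
have : i %% n < n by rewrite ltn_mod.
have sm : n = (size m).+2 by rewrite /n /w -ew /= size_rcons.
case: (i %% n) => [|k] h.
  by rewrite /= modn_small ?eqxx ?(negPf xy).
rewrite /= !nth_rcons addn1; case: ltngtP => hk; last first.
- by rewrite hk -sm modnn !eqxx (negPf xy).
- by lia.
by rewrite modn_small //; lia.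
Qed.

Let cnt r k := \sum_(j < k) isy (r * K + j).

(** Summing [isyD] over [k] consecutive positions telescopes the divisibility terms. *)
Let cntS r k : cnt r.+1 k + (n %| r * K + k) = cnt r k + (n %| r * K).
Proof.
rewrite /cnt; elim: k => [|k IHk]; first by rewrite !big_ord0 addn0.
rewrite !big_ord_recr /=.
have -> : r.+1 * K + k = r * K + k + K by rewrite mulSn; lia.
by rewrite addnS -[LHS]addnA isyD addnCA IHk [RHS]addnAC [RHS]addnC.
Qed.

(* Summing isyD over the closed orbit of 0 under the rotation, the visits of 0
   and of -1 balance, so -1 lies on that orbit. *)
Let rotation_transitive : exists r, n %| (r * K).+1.
Proof.
have tele N : isy (N * K) + \sum_(r < N) (n %| (r * K).+1)
            = isy 0 + \sum_(r < N) (n %| r * K).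
  elim: N => [|N IHN]; first by rewrite !big_ord0 mul0n.
  rewrite !big_ord_recr /= mulSnr.
  by rewrite addnCA isyD addnCA addnA IHN addnA.
have := tele n; rewrite {1}/isy modnMr /isy mod0n => /addnI.
case: (boolP [exists r : 'I_n, n %| (r * K).+1]) => [/existsP[r hr]|].
  by move=> _; exists r.
rewrite negb_exists => /forallP no; rewrite big1; last first.
  by move=> r _; rewrite (negPf (no r)).
have n0 : 0 < n by lia.
by rewrite (bigD1 (Ordinal n0)) //= mul0n dvdn0.
Qed.

(** The range 1 to [n] puts position [K] first and position 0 last, so that no step between two
    indices starts at position 0. *)
Let rotation_index s : exists2 r, 0 < r <= n & r * K = s %[mod n].
Proof.
have [r0 h0] := rotation_transitive.
(* Both [n.-1] and [r0 * K] are -1 modulo [n], so [r1 * K] is [s]. *)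
pose r1 := s * n.-1 * r0.
have e1 : r1 * K = s %[mod n].
  have h : r1 * K + s * n.-1 = s + s * n.-1 %[mod n].
    have -> : r1 * K + s * n.-1 = s * n.-1 * (r0 * K).+1 by rewrite /r1; nia.
    have -> : s + s * n.-1 = s * n by rewrite -{2}(prednK (ltnW n_gt1)); nia.
    by rewrite modnMl; apply/eqP; apply: dvdn_mull.
  by move/eqP: h; rewrite eqn_modDr => /eqP.
have e2 : (r1 %% n) * K = s %[mod n] by rewrite modnMml.
have [z|nz] := posnP (r1 %% n).
  by exists n; [rewrite leqnn ltnW | rewrite modnMr -e2 z mul0n mod0n].
by exists (r1 %% n); rewrite // nz ltnW // ltn_mod ltnW.
Qed.

Let index_ndvd r : 0 < r < n -> ~~ (n %| r * K).
Proof.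
have [r0 h0] := rotation_transitive.
have co : coprime n K.
  apply/eqP; have := dvdn_gcdl n K; have := dvdn_gcdr n K.
  set d := gcdn n K => dK dn; apply/eqP; rewrite -dvdn1.
  by rewrite -(dvdn_addr 1 (dvdn_mull r0 dK)) addn1 (dvdn_trans dn).
by move=> /andP[r_gt0 r_ltn]; rewrite Gauss_dvdl // gtnNdvd.
Qed.

Let cnt_anti r t k : 0 < r -> r <= t -> t <= n -> cnt t k <= cnt r k.
Proof.
move=> r0; elim: t => [|t IHt]; first by lia.
rewrite leq_eqVlt => /orP[/eqP->//|rt] tn.
have /negPf nd : ~~ (n %| t * K) by apply: index_ndvd; lia.
have := cntS t k; rewrite nd; have := IHt rt (ltnW tn); lia.
Qed.

(** The prefixes of length [K - t'], which fit in the windows, already differ: since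
    [(r' - 1) * K + (K - t')] is 0 modulo [n], the step from [r' - 1] to [r'] loses a [y] there, and
    [cnt_anti] forbids an earlier gain. *)
Let cut_window_neq r t r' t' l : 0 < r < r' -> r' <= n ->
  r * K = t %[mod n] -> r' * K = t' %[mod n] ->
  t + l <= n -> t' + l <= n -> t' <= K -> K <= t' + l ->
  window w t l <> window w t' l.
Proof.
case: r' => [|r']; first by lia.
move=> rr rn er er' tn t'n t'K Kt' e.
have /negPf nd : ~~ (n %| r' * K) by apply: index_ndvd; lia.
have dv : n %| r' * K + (K - t').
  rewrite /dvdn -(mod0n n) -(eqn_modDr t') -addnA subnK // add0n -er'.
  by rewrite mulSn addnC.
have : cnt r (K - t') = cnt r'.+1 (K - t').
  apply: eq_bigr => j _; have jl : j < l by have := ltn_ord j; lia.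
  have mods q d : q * K = d %[mod n] -> d + l <= n -> (q * K + j) %% n = d + j.
    move=> eq dn; rewrite -modnDml eq modnDml.
    by rewrite modn_small ?(leq_trans _ dn) ?ltn_add2l.
  rewrite /isy (mods r t) // (mods _ _ er') //.
  by rewrite -(nth_window x w t jl) e nth_window.
have := cntS r' (K - t'); rewrite nd dv.
have : cnt r' (K - t') <= cnt r (K - t') by apply: cnt_anti; lia.
lia.
Qed.

Lemma cut_occurrence_unique_central : cut_occurrence_unique K w.
Proof.
move=> s t l sK Ks sn tK Kt tn e.
have [r hr er] := rotation_index s; have [r' hr' er'] := rotation_index t.
case: (ltngtP r r') => h.
- by case: (@cut_window_neq r s r' t l) => //; lia.
- by case: (@cut_window_neq r' t r s l) => //; lia.
- have : s = t %[mod n] by rewrite -er -er' h.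
  (* An empty window at the cut starts at [K]; a nonempty one starts below [n], where congruence is
     equality. *)
  have [l0|l0] := posnP l; first by lia.
  by rewrite !modn_small //; lia.
Qed.

(** * Moving an occurrence to the cut *)

Let nth_inner i : 0 < i < n.-1 -> nth x w i = nth x (y :: rcons m x) i.
Proof.
have -> : n = (size m).+2 by rewrite /n /w -ew /= size_rcons.
by rewrite /w -ew; case: i => // i /= im; rewrite !nth_rcons -ltnS im.
Qed.

Let nthD i : 0 < i -> i + K < n -> nth x w (i + K) = nth x w i.
Proof.
move=> i0 iK; rewrite -[i + K in LHS](modn_small iK) nth_rot_w; last by lia.
by rewrite nth_inner //; lia.
Qed.

(** The bound leaves out [i = K - 1], which comes from the last position, where the rotation changes
    the letter. *)
Let nthB i : i.+1 < K -> nth x w i = nth x w (i + (n - K)).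
Proof.
move=> iK; have e : (i + (n - K) + K) %% n = i.
  by rewrite -addnA subnK ?modnDr ?modn_small //; lia.
by rewrite -{1}e nth_rot_w ?nth_inner //; lia.
Qed.

(** Induction on the rotation index of [s]: a nonempty window that misses the cut is moved back by
    [K] modulo [n]. Missing it strictly keeps the new window within [w] and away from positions 0
    and [n - 1]. *)
Lemma cut_occurrence_exists : occurs_at_cut K w.
Proof.
move=> s l sn; have [r /andP[r0 _]] := rotation_index s.
elim: r r0 s sn => // r IHr _ s sn er.
have [l0|l0] := posnP l.
  by exists K; rewrite l0 addn0 /window !take0; split; rewrite // ltnW.
have [sK|Ks] := leqP s K; first have [Ks|sK'] := leqP K (s + l).
- by exists s.
- have e0 : r * K = s + (n - K) %[mod n].
    apply/eqP; rewrite -(eqn_modDr K) -addnA subnK 1?ltnW // modnDr.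
    by rewrite -er mulSn addnC.
  (* Index 0 would make the new start 0 modulo [n], but it lies strictly between 0 and [n]. *)
  have r0 : 0 < r.
    case: r e0 {IHr er} => // ; rewrite mul0n mod0n modn_small; lia.
  have [|t [t1 t2 t3 et]] := IHr r0 (s + (n - K)) _ e0; first by lia.
  exists t; split=> //; rewrite et.
  apply: (eq_window (x0 := x)) => // [|i il]; first by lia.
  by rewrite (nthB (i := s + i)); [congr nth|]; lia.
- have e0 : r * K = s - K %[mod n].
    by apply/eqP; rewrite -(eqn_modDr K) subnK 1?ltnW // -er mulSn addnC.
  have r0 : 0 < r.
    case: r e0 {IHr er} => // ; rewrite mul0n mod0n modn_small; lia.
  have [|t [t1 t2 t3 et]] := IHr r0 (s - K) _ e0; first by lia.
  exists t; split=> //; rewrite et.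
  apply: (eq_window (x0 := x)) => // [|i il]; first by lia.
  by rewrite -nthD; [congr nth| |]; lia.
Qed.

End Rotation.

Lemma central_symmetric (x y : letter) (m u v : word) : x != y ->
  palindrome m -> palindrome u -> palindrome v -> x :: rcons m y = u ++ v ->
  strongly_factor_symmetric (x :: rcons m y).
Proof.
move=> xy pm pu pv ew; rewrite ew; apply: unique_cut_occurrence_symmetric => //.
- exact: cut_occurrence_exists xy pm pu pv ew.
- exact: cut_occurrence_unique_central xy pm pu pv ew.
Qed.

Theorem theorem1 (w : word) (hw : christoffel w) : strongly_factor_symmetric w.
Proof.
case: hw => [->|->|[m [pm wm [u [v [pu pv ew]]]]]].
- exact: letter_symmetric.
- exact: letter_symmetric.
by case: wm => wm; rewrite wm in ew *; apply: (central_symmetric _ pm pu pv ew).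
Qed.
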